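(* Let $p,q,n$ be positive integers and let $b_1 \leq \ldots \leq b_n$ be positive integers. If there exists a positive integer $k$ such that $k\leq b_1$ and $\gcd(p+q,k) > p$, then Avoider has a winning strategy in the game $mBox(b_1, \ldots, b_n,(p,q))$, both when Avoider is the first player and when he is the second player.
   Context: A $(p,q)$ Avoider-Enforcer game on a finite board $X$ with a family $\mathcal F\subseteq 2^X$ of target sets is played as follows (strict rules): Avoider and Enforcer alternately claim exactly $p$ and exactly $q$ previously unclaimed elements of $X$ per move, respectively; if before a player's move fewer than $p$ (for Avoider) or $q$ (for Enforcer) unclaimed elements remain, that player claims all of them. It is specified which player moves first. The game ends when all elements are claimed; Avoider loses if at the end he has claimed all elements of some target set, otherwise Avoider wins. The misère box game $mBox(b_1,\ldots,b_n,(p,q))$ is the $(p,q)$ Avoider-Enforcer game (strict rules) whose board is the disjoint union of pairwise disjoint sets (boxes) $B_1,\ldots,B_n$ with $|B_i|=b_i$, and whose target sets are exactly $B_1,\ldots,B_n$. *)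

(* Defs.v *)
From mathcomp Require Import all_boot.

Set Implicit Arguments.
Unset Strict Implicit.
Unset Printing Implicit Defensive.

Inductive player := Avoider | Enforcer.

Definition opponent (pl : player) : player :=
  match pl with Avoider => Enforcer | Enforcer => Avoider end.

Definition is_avoider (pl : player) : bool :=
  match pl with Avoider => true | Enforcer => false end.

(* Moves are numbered from 0; [first] makes move 0. *)
Definition mover (first : player) (i : nat) : player :=
  if odd i then opponent first else first.

Definition bias (p q : nat) (pl : player) : nat :=
  match pl with Avoider => p | Enforcer => q end.

(* A history is the chronological sequence of the sets claimed at each move;
   the board is the whole of [X]. *)
Definition unclaimed (X : finType) (h : seq {set X}) : {set X} :=
  ~: \bigcup_(m <- h) m.

Definition avoider_set (X : finType) (first : player) (h : seq {set X}) :
    {set X} :=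
  \bigcup_(i < size h | is_avoider (mover first i)) nth set0 h i.

(* Strict rules: exactly [p] (resp. [q]) elements, or all the remaining ones if
   there are fewer. *)
Definition legal_move (X : finType) (p q : nat) (first : player)
    (h : seq {set X}) (m : {set X}) : Prop :=
  m \subset unclaimed h /\
  #|m| = minn (bias p q (mover first (size h))) #|unclaimed h|.

Inductive legal_play (X : finType) (p q : nat) (first : player) :
    seq {set X} -> Prop :=
| legal_play_nil : legal_play p q first [::]
| legal_play_rcons h m :
    legal_play p q first h -> unclaimed h != set0 ->
    legal_move p q first h m -> legal_play p q first (rcons h m).

Definition finished (X : finType) (h : seq {set X}) : Prop :=
  unclaimed h = set0.

Definition avoider_strategy (X : finType) (p q : nat) (first : player)
    (s : seq {set X} -> {set X}) : Prop :=
  forall h, legal_play p q first h -> ~ finished h ->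
    mover first (size h) = Avoider -> legal_move p q first h (s h).

Definition avoider_follows (X : finType) (first : player)
    (s : seq {set X} -> {set X}) (h : seq {set X}) : Prop :=
  forall i, i < size h -> mover first i = Avoider ->
    nth set0 h i = s (take i h).

Definition avoider_loses (X : finType) (F : {set {set X}}) (first : player)
    (h : seq {set X}) : Prop :=
  exists2 T, T \in F & T \subset avoider_set first h.

Definition avoider_has_winning_strategy (X : finType) (F : {set {set X}})
    (p q : nat) (first : player) : Prop :=
  exists2 s : seq {set X} -> {set X},
    avoider_strategy p q first s &
    forall h, legal_play p q first h -> finished h ->
      avoider_follows first s h -> ~ avoider_loses F first h.

(* The board [X] is the disjoint union of boxes [B i] of sizes [b i]. *)
Definition is_box_board (n : nat) (b : 'I_n -> nat) (X : finType)
    (B : 'I_n -> {set X}) : Prop :=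
  [/\ forall i, #|B i| = b i,
      forall i j, i != j -> [disjoint B i & B j] &
      \bigcup_i B i = [set: X]].

Definition boxes (n : nat) (X : finType) (B : 'I_n -> {set X}) :
    {set {set X}} :=
  [set B i | i : 'I_n].

(* Main.v *)
Require Import Defs.
From mathcomp Require Import all_boot zify.

Set Implicit Arguments.
Unset Strict Implicit.
Unset Printing Implicit Defensive.

(** Put [d = gcd (p + q, k)], so that [d] divides [p + q], [p < d], and every
    box contains a core of exactly [d] elements.  A core is alive as long as
    Enforcer has claimed none of its elements, and Avoider has to leave every
    alive core incomplete.  Elements outside the alive cores are safe for
    Avoider, and he plays only those whenever he can.

    Since [d] divides [p + q], the number of unclaimed elements before
    Avoider's moves is constant modulo [d].  If all alive cores are untouched
    and only [s < p] safe elements remain, then Avoider takes these and [p - s]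
    elements of one alive core; [d - p + s > 0] elements of that core remain.
    As long as this core stays alive, the number of safe elements before each
    of Avoider's moves is congruent to [p] modulo [d], hence at least [p], so
    Avoider never needs to touch another core.  Once Enforcer kills it, all
    alive cores are untouched again. *)

(** * Subsets of given size and congruences *)

Lemma exists_subset_card (T : finType) (A : {set T}) (k : nat) :
  k <= #|A| -> exists2 m : {set T}, m \subset A & #|m| = k.
Proof.
rewrite cardE => le_k; exists [set x in take k (enum A)].
  by apply/subsetP => x; rewrite inE => /mem_take; rewrite mem_enum.
rewrite cardsE; have /card_uniqP -> : uniq (take k (enum A)).
  by rewrite take_uniq // enum_uniq.
by rewrite size_take_min; lia.
Qed.

(** With multipliers on both sides, congruences become linear equations free of truncated
    subtraction, which [lia] can combine. *)
Lemma eqn_modP (d a b : nat) :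
  (a == b %[mod d]) <-> exists u v, a + u * d = b + v * d.
Proof.
split=> [/eqP eq_ab|[u [v eq_ab]]].
  exists (b %/ d), (a %/ d).
  by rewrite {1}(divn_eq a d) {2}(divn_eq b d) eq_ab; lia.
by rewrite -(modnMDl u a) -(modnMDl v b) addnC eq_ab addnC.
Qed.

(** * Strategies from invariants of positions *)

Section Positions.

Variables (X : finType) (p q : nat) (first : player).
Implicit Types (h : seq {set X}) (m : {set X}).

Lemma mover_succ i : mover first i.+1 = opponent (mover first i).
Proof. by rewrite /mover /=; case: (odd i); case: first. Qed.

Lemma unclaimed_nil : unclaimed [::] = [set: X].
Proof. by rewrite /unclaimed big_nil setC0. Qed.

Lemma unclaimed_rcons h m : unclaimed (rcons h m) = unclaimed h :\: m.
Proof. by rewrite /unclaimed -cats1 big_cat big_seq1 setCU setDE. Qed.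

Lemma avoider_set_nil : avoider_set first [::] = set0 :> {set X}.
Proof. by rewrite /avoider_set big_ord0. Qed.

Lemma avoider_set_rcons h m :
  avoider_set first (rcons h m) =
  if is_avoider (mover first (size h)) then avoider_set first h :|: m
  else avoider_set first h.
Proof.
rewrite /avoider_set size_rcons big_mkcond big_ord_recr /= nth_rcons ltnn eqxx.
have -> : \bigcup_(i < size h) (if is_avoider (mover first i)
              then nth set0 (rcons h m) i else set0) =
          \bigcup_(i < size h) (if is_avoider (mover first i)
              then nth set0 h i else set0).
  by apply: eq_bigr => i _; rewrite nth_rcons ltn_ord.
rewrite -big_mkcond.
by case: (is_avoider (mover first (size h))); rewrite //= setU0.
Qed.

Lemma avoider_follows_rcons (s : seq {set X} -> {set X}) h m :
  avoider_follows first s (rcons h m) ->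
  avoider_follows first s h /\
  (mover first (size h) = Avoider -> m = s h).
Proof.
move=> fol; split=> [i lt_i av|av].
  have := fol i; rewrite size_rcons nth_rcons lt_i => -> //; last exact: ltnW.
  by rewrite -cats1 takel_cat // ltnW.
have := fol (size h); rewrite size_rcons nth_rcons ltnn eqxx => -> //.
by rewrite -cats1 take_size_cat.
Qed.

(* A position is given by Avoider's elements [A] and the unclaimed elements
   [U]; [Inv pl A U] is an invariant for positions with [pl] to move. *)
Lemma invariant_winning_strategy (F : {set {set X}})
    (Inv : player -> {set X} -> {set X} -> bool) :
  Inv first set0 setT ->
  (forall A U, Inv Avoider A U -> exists m,
     [/\ m \subset U, #|m| = minn p #|U| & Inv Enforcer (A :|: m) (U :\: m)]) ->
  (forall A U m, Inv Enforcer A U -> m \subset U -> #|m| = minn q #|U| ->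
     Inv Avoider A (U :\: m)) ->
  (forall pl A U T, Inv pl A U -> T \in F -> ~~ (T \subset A)) ->
  avoider_has_winning_strategy F p q first.
Proof.
move=> Inv0 InvA InvE InvF.
(* A strategy must answer legally in every legal history, so legality is unconditional, while [Inv]
   has to be preserved only where it holds. Hence a good move always exists, and [s] never falls
   back on [set0]. *)
pose good h m := [&& m \subset unclaimed h, #|m| == minn p #|unclaimed h| &
  Inv Avoider (avoider_set first h) (unclaimed h) ==>
  Inv Enforcer (avoider_set first h :|: m) (unclaimed h :\: m)].
pose s h := odflt set0 [pick m | good h m].
have goodP h : good h (s h).
  rewrite /s; case: pickP => //= no_good.
  have [/InvA[m [sub card_m inv]]|noInv] :=
    boolP (Inv Avoider (avoider_set first h) (unclaimed h)).
    by have := no_good m; rewrite /good sub card_m eqxx inv implybT.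
  have [m sub card_m] := exists_subset_card (geq_minr p #|unclaimed h|).
  by have := no_good m; rewrite /good sub card_m eqxx (negPf noInv).
exists s => [h _ _ av|h play _ fol [T TF]].
  by rewrite /legal_move av; case/and3P: (goodP h) => ? /eqP.
apply/negP; apply: InvF TF.
instantiate (1 := unclaimed h); instantiate (1 := mover first (size h)).
elim: play fol => [_|{}h m _ IH _ [sub card_m] /avoider_follows_rcons[fol def_m]].
  by rewrite avoider_set_nil unclaimed_nil.
move: (IH fol); rewrite avoider_set_rcons unclaimed_rcons size_rcons mover_succ.
move: card_m def_m; case: (mover first (size h)) => /= card_m def_m inv.
  by rewrite def_m //; case/and3P: (goodP h) => _ _ /implyP; apply.
exact: InvE.
Qed.

End Positions.

(** * Cores and the counting of safe elements *)

Section Cores.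

Variables (X : finType) (n d : nat) (C : 'I_n -> {set X}).
Hypothesis cardC : forall i, #|C i| = d.
Hypothesis disjC : forall i j, i != j -> [disjoint C i & C j].
Implicit Types A U m : {set X}.

(** [A :|: U] is the complement of Enforcer's set, which therefore needs no record of its own. *)
Definition alive A U i := C i \subset A :|: U.

Definition live A U := \bigcup_(i | alive A U i) C i.

Definition safe A U := U :\: live A U.

Definition untouched A U :=
  [disjoint A & U] && [forall i, alive A U i ==> [disjoint C i & A]].

(* Used with [r = p] before Avoider's moves and [r = 0] before Enforcer's. *)
Definition one_touched r A U :=
  [disjoint A & U] &&
  [exists i, [&& alive A U i, ~~ (C i \subset A),
    #|U| == r + #|C i :\: A| %[mod d] &
    [forall j, alive A U j ==> (j != i) ==> [disjoint C j & A]]]].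

Lemma dvdn_card_live A U : d %| #|live A U|.
Proof.
rewrite /live big_mkcond -sum1_card partition_disjoint_bigcup /=.
  apply: dvdn_sum => i _; rewrite sum1_card.
  by case: ifP => _; rewrite ?cardC ?dvdnn ?cards0 ?dvdn0.
move=> i j ij; case: ifP => _; last by rewrite disjoints_subset sub0set.
by case: ifP => _; [exact: disjC | rewrite disjoints_subset setC0 subsetT].
Qed.

Lemma live_sub A U : live A U \subset A :|: U.
Proof. exact/bigcupsP. Qed.

Lemma core_sub_live A U i : alive A U i -> C i \subset live A U.
Proof. exact: bigcup_sup. Qed.

(** As [live A U] lies in [A :|: U], its unclaimed part is [live A U :\: A]; Avoider's share
    completes this to [live A U]. *)
Lemma card_safe A U : [disjoint A & U] ->
  #|U| + #|live A U :&: A| = #|safe A U| + #|live A U|.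
Proof.
move=> disjAU; rewrite /safe -(cardsID (live A U) U) -(cardsID A (live A U)).
have -> : live A U :\: A = U :&: live A U; last by lia.
apply/setP => x; rewrite !inE andbC.
have /subsetP/(_ x) := live_sub A U; rewrite !inE.
have /setDidPl/setP/(_ x) := disjAU; rewrite !inE.
by case: (x \in A); case: (x \in U); case: (x \in live A U) => //= _ /(_ isT).
Qed.

Lemma untouched_live A U : untouched A U -> live A U :&: A = set0.
Proof.
case/andP=> _ /forallP unt; apply/eqP; rewrite setI_eq0.
rewrite disjoints_subset; apply/bigcupsP => i al.
by rewrite -disjoints_subset; have := unt i; rewrite al.
Qed.

Lemma one_touched_live A U i : alive A U i ->
  (forall j, alive A U j -> j != i -> [disjoint C j & A]) ->
  live A U :&: A = C i :&: A.
Proof.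
move=> al unt; apply/eqP; rewrite eqEsubset; apply/andP; split;
  last exact: setSI (core_sub_live al).
apply/subsetP => x /setIP[/bigcupP[j alj xj] xA]; rewrite inE xA andbT.
have [<- //|ji] := eqVneq j i.
by have /disjointFr/(_ xj) := unt j alj ji; rewrite xA.
Qed.

(** Avoider's moves leave Enforcer's set, and so the collection of alive cores, unchanged. *)
Lemma move_union A U m : m \subset U -> (A :|: m) :|: (U :\: m) = A :|: U.
Proof.
move=> /subsetP sub; apply/setP => x; rewrite !inE.
by have := sub x; case: (x \in m) => [->|_]; rewrite ?orbT ?orbF.
Qed.

Lemma move_disjoint A U m : [disjoint A & U] -> m \subset U ->
  [disjoint A :|: m & U :\: m].
Proof.
move=> disjAU sub; rewrite -setI_eq0 setIUl setU_eq0 !setI_eq0.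
rewrite (disjointWr (subsetDl _ _)) //=.
by rewrite -setI_eq0 setIDA setIC -setIDA; apply/eqP/setP => x; rewrite !inE;
   case: (x \in m); rewrite ?andbF.
Qed.

Lemma safe_disjoint_core A U m i : m \subset safe A U -> alive A U i ->
  [disjoint C i & m].
Proof.
move=> sub al; apply: (disjointW (core_sub_live al) sub).
by rewrite -setI_eq0; apply/eqP/setP => x; rewrite !inE; case: (x \in live A U).
Qed.

Lemma disjoint_setU A (B D : {set X}) :
  [disjoint A & B :|: D] = [disjoint A & B] && [disjoint A & D].
Proof. by rewrite -!setI_eq0 setIUr setU_eq0. Qed.

Lemma setD_disjoint A (B D : {set X}) : [disjoint A & D] ->
  A :\: (B :|: D) = A :\: B.
Proof.
by move=> /setDidPl disjAD; rewrite -[in RHS]disjAD setDDl setUC.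
Qed.

Lemma untouched_safe_move A U m : untouched A U -> m \subset safe A U ->
  untouched (A :|: m) (U :\: m).
Proof.
move=> /andP[disjAU /forallP unt] sub_safe.
have sub := subset_trans sub_safe (subsetDl _ _).
apply/andP; split; first exact: move_disjoint.
apply/forallP => i; apply/implyP; rewrite /alive move_union // => al.
rewrite disjoint_setU (safe_disjoint_core sub_safe al) andbT.
by have := unt i; rewrite /alive al.
Qed.

(** * Avoider's replies *)

Variable p : nat.
Hypothesis ltpd : p < d.

Lemma untouched_avoider_move A U : untouched A U -> exists m,
  [/\ m \subset U, #|m| = minn p #|U| &
      untouched (A :|: m) (U :\: m) || one_touched 0 (A :|: m) (U :\: m)].
Proof.
move=> unt; have [disjAU /forallP untP] := andP unt.
have [enough|lack] := leqP (minn p #|U|) #|safe A U|.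
  have [m sub card_m] := exists_subset_card enough.
  exists m; split=> //; first exact: subset_trans sub (subsetDl _ _).
  by rewrite untouched_safe_move.
have := card_safe disjAU; rewrite untouched_live // cards0 addn0 => cardU.
have [t card_live] := dvdnP (dvdn_card_live A U).
(* Without alive cores all of [U] would be safe, against [lack]. *)
have [i al] : exists i, alive A U i.
  apply/existsP; apply: contraTT lack; rewrite negb_exists => /forallP none.
  suff -> : safe A U = U by rewrite -leqNgt geq_minr.
  by rewrite /safe /live big_pred0 ?setD0 // => j; apply/negbTE.
have disjCA : [disjoint C i & A] by have := untP i; rewrite al.
have subCU : C i \subset U.
  by apply/subsetP => x xC; have := subsetP al x xC;
     rewrite inE (disjointFr disjCA xC).
have leC : p - #|safe A U| <= #|C i| by rewrite cardC (leq_trans (leq_subr _ _)) // ltnW.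
have [m' sub' card_m'] := exists_subset_card leC.
have disjm : [disjoint safe A U & m'].
  rewrite disjoint_sym; apply: disjointWl sub' _.
  exact: safe_disjoint_core al.
(* The chosen core is still wholly unclaimed, so more than [p] elements remain and Avoider takes
   exactly [p]. *)
have leU : d <= #|U| by rewrite -(cardC i) subset_leq_card.
pose m := safe A U :|: m'.
have sub : m \subset U by rewrite subUset subsetDl (subset_trans sub').
have card_m : #|m| = p.
  rewrite cardsU (disjoint_setI0 disjm) cards0 card_m' subn0 subnKC //.
  by rewrite (leq_trans (ltnW lack)) // geq_minl.
exists m; split=> //; first by rewrite card_m (minn_idPl (ltnW (leq_trans ltpd leU))).
have cardCA : #|C i :\: (A :|: m)| = d - (p - #|safe A U|).
  have -> : C i :\: (A :|: m) = C i :\: m'.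
    rewrite /m setUA [_ :|: m']setUC setD_disjoint //.
    by rewrite disjoint_setU disjCA (safe_disjoint_core (subxx _) al).
  by rewrite cardsD (setIidPr sub') cardC card_m'.
apply/orP; right; apply/andP; split; first exact: move_disjoint.
apply/existsP; exists i; apply/and4P; split.
- by rewrite /alive move_union.
- by rewrite -setD_eq0 -cards_eq0 cardCA subn_eq0 -ltnNge (leq_ltn_trans (leq_subr _ _)).
- rewrite cardCA cardsD (setIidPr sub) card_m; apply/eqn_modP.
  by exists 1, t; clear -cardU card_live lack ltpd leU; lia.
apply/forallP => j; apply/implyP; rewrite /alive move_union // => alj.
apply/implyP => ji; rewrite !disjoint_setU (safe_disjoint_core (subxx _) alj).
rewrite (disjointWr sub') ?disjC // !andbT.
by have := untP j; rewrite /alive alj.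
Qed.

Lemma one_touched_avoider_move A U : one_touched p A U -> exists m,
  [/\ m \subset U, #|m| = minn p #|U| & one_touched 0 (A :|: m) (U :\: m)].
Proof.
case/andP=> disjAU /existsP[i /and4P[al nsub modU /forallP unt]].
have untP j : alive A U j -> j != i -> [disjoint C j & A].
  by move=> alj ji; have := unt j; rewrite alj ji.
have := card_safe disjAU; rewrite (one_touched_live al untP) => cardU.
have [t card_live] := dvdnP (dvdn_card_live A U).
have [u [v eqU]] := (eqn_modP _ _ _).1 modU.
have := cardsID A (C i); rewrite cardC => cardCi.
(* Modulo [d], [live A U] counts as 0 and the two parts of [C i] cancel in [cardU], which leaves the
   [p] of [modU]. *)
have mod_safe : #|safe A U| == p %[mod d].
  apply/eqn_modP; exists (t + u), (v + 1).
  by clear -cardU card_live eqU cardCi; lia.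
have enough : p <= #|safe A U|.
  (* Below [d] congruent numbers are equal, so fewer than [p] safe elements cannot be congruent to
     [p]. *)
  rewrite leqNgt; apply/negP => lt_p; move: mod_safe.
  by rewrite !modn_small ?(ltn_trans lt_p) // => /eqP; lia.
have leU : #|safe A U| <= #|U| by rewrite subset_leq_card ?subsetDl.
have [m sub_safe card_m] := exists_subset_card enough.
have sub := subset_trans sub_safe (subsetDl _ _).
exists m; split=> //; first by rewrite card_m (minn_idPl (leq_trans enough leU)).
have disjm j : alive A U j -> [disjoint C j & m].
  exact: safe_disjoint_core sub_safe.
apply/andP; split; first exact: move_disjoint.
apply/existsP; exists i; rewrite -setD_eq0 setD_disjoint ?disjm // setD_eq0.
apply/and4P; split=> //.
- by rewrite /alive move_union.
- rewrite cardsD (setIidPr sub) card_m; apply/eqn_modP.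
  by exists u, v; clear -eqU enough leU; lia.
apply/forallP => j; apply/implyP; rewrite /alive move_union // => alj.
by apply/implyP => ji; rewrite disjoint_setU untP ?disjm.
Qed.

(** * Enforcer's moves, which can only kill cores *)

Lemma alive_sub A U U' i : U' \subset U -> alive A U' i -> alive A U i.
Proof. by move=> sub /subset_trans; apply; apply: setUS. Qed.

Lemma untouched_enforcer_move A U m : untouched A U ->
  untouched A (U :\: m).
Proof.
case/andP=> disjAU /forallP unt; apply/andP; split.
  exact: disjointWr (subsetDl _ _) disjAU.
apply/forallP => i; apply/implyP => /(alive_sub (subsetDl _ _)) al.
by have := unt i; rewrite al.
Qed.

(** If the touched core dies, all alive cores are untouched. If it survives, exactly [q] elements
    leave [U], and [- q] is congruent to [p] modulo [d]. *)
Lemma one_touched_enforcer_move q A U m : d %| p + q -> one_touched 0 A U ->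
  m \subset U -> #|m| = minn q #|U| ->
  untouched A (U :\: m) || one_touched p A (U :\: m).
Proof.
move=> dvdpq /andP[disjAU /existsP[i /and4P[al nsub modU /forallP unt]]].
move=> sub card_m.
have disjAU' : [disjoint A & U :\: m] := disjointWr (subsetDl _ _) disjAU.
have untP j : alive A (U :\: m) j -> j != i -> [disjoint C j & A].
  move=> /(alive_sub (subsetDl _ _)) alj ji.
  by have := unt j; rewrite alj ji.
have [al'|dead] := boolP (alive A (U :\: m) i); last first.
  apply/orP; left; rewrite /untouched disjAU'; apply/forallP => j.
  by apply/implyP => alj; apply: untP => //; apply: contraNneq dead => <-.
apply/orP; right; rewrite /one_touched disjAU'; apply/existsP; exists i.
apply/and4P; split=> //; last first.
  by apply/forallP => j; apply/implyP => alj; apply/implyP; apply: untP.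
have cardU' : #|U :\: m| = #|U| - #|m| by rewrite cardsD (setIidPr sub).
(* Otherwise Enforcer would claim all of [U], and the surviving core would lie in [A], against
   [nsub]. *)
have gtq : q < #|U|.
  rewrite ltnNge; apply: contra nsub => leU.
  have U'0 : U :\: m = set0 by apply: cards0_eq; clear -cardU' card_m leU; lia.
  by move: al'; rewrite /alive U'0 setU0.
have [t eq_pq] := dvdnP dvdpq; have [u [v eqU]] := (eqn_modP _ _ _).1 modU.
apply/eqn_modP; exists (u + t), v.
by clear -cardU' card_m gtq eq_pq eqU; lia.
Qed.

End Cores.

(** * Choice of the cores and the invariant *)

Theorem theorem1p2 (p q n : nat) (hp : 0 < p) (hq : 0 < q) (hn : 0 < n)
    (b : 'I_n -> nat) (hb : forall i, 0 < b i)
    (hb_sorted : forall i j : 'I_n, i <= j -> b i <= b j)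
    (hk : exists k : nat,
       [/\ 0 < k, k <= b (Ordinal hn) & p < gcdn (p + q) k])
    (X : finType) (B : 'I_n -> {set X}) (hB : is_box_board b B) :
  avoider_has_winning_strategy (boxes B) p q Avoider /\
  avoider_has_winning_strategy (boxes B) p q Enforcer.
Proof.
case: hk => k [k_gt0 le_kb]; set d := gcdn _ _ => ltpd.
case: hB => cardB disjB _.
have dvdpq : d %| p + q := dvdn_gcdl _ _.
have le_dB i : d <= #|B i|.
  rewrite cardB (leq_trans _ (hb_sorted (Ordinal hn) i _)) //.
  exact: leq_trans (dvdn_leq k_gt0 (dvdn_gcdr _ _)) le_kb.
have /fin_all_exists2[C subC cardC] i := exists_subset_card (le_dB i).
have disjC i j : i != j -> [disjoint C i & C j].
  by move=> ij; apply: disjointW (subC i) (subC j) (disjB i j ij).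
pose Inv pl A U := untouched C A U ||
  one_touched d C (if is_avoider pl then p else 0) A U.
suff win first : avoider_has_winning_strategy (boxes B) p q first by split.
apply: (invariant_winning_strategy (Inv := Inv)).
- apply/orP; left; apply/andP; split.
    by rewrite disjoints_subset sub0set.
  apply/forallP => i; apply/implyP => _.
  by rewrite disjoints_subset setC0 subsetT.
- move=> A U /orP[|] inv; first exact: untouched_avoider_move.
  have [m [sub card_m inv']] := one_touched_avoider_move cardC disjC ltpd inv.
  by exists m; split=> //; rewrite /Inv inv' orbT.
- move=> A U m /orP[|] inv sub card_m.
    by rewrite /Inv untouched_enforcer_move.
  exact: one_touched_enforcer_move card_m.
move=> pl A U T inv /imsetP[i _ ->]; apply/negP => /(subset_trans (subC i)) CA.
(* A box inside [A] would have an alive, touched and complete core; [untouched] excludes touched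
   alive cores, and [one_touched] admits only an incomplete one. *)
have al : alive C A U i := subset_trans CA (subsetUl _ _).
have touched : ~~ [disjoint C i & A].
  rewrite -setI_eq0 (setIidPl CA) -card_gt0 cardC.
  exact: leq_ltn_trans (leq0n p) ltpd.
case/orP: inv => /andP[_].
  by move=> /forallP/(_ i); rewrite al (negPf touched).
case/existsP=> j /and4P[_ nsub _ /forallP/(_ i)]; rewrite al (negPf touched).
by have [eq_ij|//] := eqVneq i j; rewrite -eq_ij CA in nsub.
Qed.
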